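(* Let $\delta\in(0,1)$ be fixed, let $m>0$ be an integer, and suppose that $(\mathcal X,\rho)$ is a metric space such that for some $\bar t>0$ there is a $\bar t$-net $T$ of $\mathcal X$ of size $\Theta(\sqrt m)$. Consider any passive learning algorithm that maps i.i.d. samples $S_\ell\sim\mathcal D^\ell$, from a distribution $\mathcal D$ over $\mathcal X\times\{-1,1\}$, to functions $\hat h_\ell:\mathcal X\to\{-1,1\}$. For any such algorithm and any $\ell=\tilde\Theta(\sqrt m)$, there exists a distribution $\mathcal D$ over $\mathcal X\times\{-1,1\}$ such that: (i) the Bayes error of $\mathcal D$ is $\Theta(1/\sqrt m)$; (ii) with at least a constant probability, both of the following events occur: (a) the passive learner has error $\mathrm{err}(\hat h_\ell,\mathcal D)=\tilde\Omega(m^{-1/4})$; (b) $G_{\min}(m,\delta)=\tilde\Theta(1/\sqrt m)$. Furthermore, (i) and (ii) continue to hold when the learning algorithm has access to the full marginal distribution of $\mathcal D$ over $\mathcal X$.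
   Context: Asymptotic notation is with respect to $m\to\infty$; $\tilde\Theta,\tilde\Omega$ hide factors polylogarithmic in $m$; all constants in the conclusions depend only on $\delta$ and on the constants (and polylog factors) implicit in the hypotheses. The Bayes error of $\mathcal D$ is $\inf_h\mathrm{err}(h,\mathcal D)$ over (measurable) $h:\mathcal X\to\{-1,1\}$, where $\mathrm{err}(h,\mathcal D)=\mathbb P_{(X,Y)\sim\mathcal D}[h(X)\ne Y]$. There is a labeled sample $S_{\mathrm{in}}\sim\mathcal D^m$, with unlabeled part $U_{\mathrm{in}}$, and the passive learner observes $\ell$ random labeled examples $S_\ell$ from $S_{\mathrm{in}}$ (so $S_\ell\sim\mathcal D^\ell$). The quantity $G_{\min}(m,\delta)$ is computed from $S_{\mathrm{in}}$ as follows. A set $A$ is $t$-separated if $\rho(a,a')\ge t$ for distinct $a,a'\in A$; for $A\subseteq B$, $A$ is a $t$-net of $B$ if $A$ is $t$-separated and every point of $B$ is within distance $\le t$ of a point of $A$. A deterministic procedure constructing $t$-nets is fixed, with output $\mathrm{Net}(U,t)$ for a multiset $U$; $\mathcal N(t):=|\mathrm{Net}(U_{\mathrm{in}},t)|$. A labeled multiset $S$ is $(\nu,t)$-separated if there is $\tilde S\subseteq S$ with $|S\setminus\tilde S|\le\nu|S|$ such that any two points of $\tilde S$ with different labels are at distance $\ge t$; $\nu(t)$ is the smallest $\nu$ such that $S_{\mathrm{in}}$ is $(\nu,t)$-separated. For $N<m$ and $\alpha:=m/(m-N)$, \[ \mathrm{GB}(\epsilon,N,\delta,m,k):=\alpha\epsilon+\frac23\,\frac{(N+1)\log(mk)+\log(\frac1\delta)}{m-N}+\frac3{\sqrt2}\sqrt{\frac{\alpha\epsilon\,((N+1)\log(mk)+\log(\frac1\delta))}{m-N}},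 \] and $G_{\min}(m,\delta):=\min_{t>0,\ \mathcal N(t)<m}\mathrm{GB}(\nu(t),\mathcal N(t),\delta,m,1)$. *)

(* Defs.v *)
From HB Require Import structures.
From mathcomp Require Import all_boot all_order all_algebra.
From mathcomp Require Import finmap multiset.
From mathcomp Require Import all_classical all_reals all_analysis.

Set Implicit Arguments.
Unset Strict Implicit.
Unset Printing Implicit Defensive.

Import Order.TTheory GRing.Theory Num.Theory.
Import numFieldNormedType.Exports.

Local Open Scope classical_set_scope.
Local Open Scope ring_scope.

(* The library's sigma-algebras live on pointed types, so metric spaces are
   taken nonempty. *)
#[short(type="pmetricType")]
HB.structure Definition PMetric (K : numDomainType) :=
  { M of Metric K M & isPointed M }.

Notation borel X := (g_sigma_algebraType (@open X)).

(* The label 1 is [true], the label -1 is [false]. *)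
Notation labeled X := (borel X * bool)%type.

Section iid.
Context d (Z : measurableType d) (R : realType).

Lemma product_setT1 d' (Z' : measurableType d') (P : probability Z R)
    (Q : probability Z' R) : (P \x Q)%E [set: Z * Z'] = 1%E.
Proof.
rewrite -setXTT product_measure1E//.
by rewrite [X in (X * _)%E]probability_setT [X in (_ * X)%E]probability_setT mule1.
Qed.

HB.instance Definition _ d' (Z' : measurableType d') (P : probability Z R)
    (Q : probability Z' R) :=
  Measure_isProbability.Build _ _ _ (P \x Q)%E (product_setT1 P Q).

Definition tuple_cons n (z : Z * n.-tuple Z) : n.+1.-tuple Z :=
  [tuple of z.1 :: z.2].

Lemma measurable_tuple_cons n : measurable_fun [set: Z * n.-tuple Z]
  (@tuple_cons n).
Proof. exact: measurable_cons. Qed.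

HB.instance Definition _ n := isMeasurableFun.Build _ _ _ _ (@tuple_cons n)
  (@measurable_tuple_cons n).

Fixpoint iid (P : probability Z R) n : probability (n.-tuple Z) R :=
  if n is n'.+1 then
    distribution (P \x iid P n')%E (@tuple_cons n')
  else \d_[tuple].

(* Equal to [P A] when [A] is measurable. *)
Definition inner_prob (P : probability Z R) (A : set Z) : R :=
  fine (ereal_sup [set P B | B in [set B | measurable B /\ B `<=` A]]).

Lemma inner_prob_measurable (P : probability Z R) (A : set Z) :
  measurable A -> inner_prob P A = fine (P A).
Proof.
move=> mA; congr fine; apply/eqP; rewrite eq_le; apply/andP; split.
  by apply: ge_ereal_sup => _ [B [mB BA] <-]; apply: le_measure; rewrite ?inE.
by apply: ereal_sup_ubound; exists A => //; split.
Qed.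

End iid.

HB.instance Definition _ d1 d2 (T1 : measurableType d1)
    (T2 : measurableType d2) :=
  isMeasurableFun.Build _ _ _ _ (@fst T1 T2) measurable_fst.

Section learning.
Context (R : realType) (X : pmetricType R).

Definition classifier := {mfun borel X >-> bool}.

(* The learner itself is not required to be measurable in the sample. *)
Definition learner := seq (labeled X) -> classifier.

Definition err (h : borel X -> bool) (D : probability (labeled X) R) : R :=
  fine (D [set z | h z.1 != z.2]).

Definition bayes_error (D : probability (labeled X) R) : R :=
  inf [set err h D | h in [set: classifier]].

Definition marginal (D : probability (labeled X) R) : probability (borel X) R :=
  distribution D (@fst (borel X) bool).

Definition is_separated (t : R) (A : set X) :=
  forall a a', A a -> A a' -> a != a' -> t <= mdist a a'.

Definition is_net (t : R) (A B : set X) :=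
  [/\ A `<=` B, is_separated t A &
      forall b, B b -> exists2 a, A a & mdist b a <= t].

Definition is_net_procedure (Net : multiset X -> R -> {fset X}) :=
  forall (U : multiset X) (t : R), 0 < t ->
    is_net t [set x | x \in Net U t] [set x | x \in U].

Definition label_separated (S : multiset (labeled X)) (nu t : R) :=
  exists S' : multiset (labeled X),
    [/\ (S' `<=` S)%mset, (size (S `\` S')%mset)%:R <= nu * (size S)%:R &
        forall z z', z \in S' -> z' \in S' -> z.2 != z'.2 ->
          t <= mdist (z.1 : X) (z'.1 : X)].

(* The infimum is a minimum when [S] is not empty. *)
Definition min_sep (S : multiset (labeled X)) (t : R) : R :=
  inf [set nu | label_separated S nu t].

Definition GB (eps : R) (N : nat) (delta : R) (m k : nat) : R :=
  let alpha := m%:R / (m%:R - N%:R) in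
  let c := N.+1%:R * ln (m * k)%:R + ln (delta^-1) in
  alpha * eps + 2 / 3 * (c / (m%:R - N%:R))
    + 3 / Num.sqrt 2 * Num.sqrt (alpha * eps * c / (m%:R - N%:R)).

Section Gmin.
Variables (Net : multiset X -> R -> {fset X}) (delta : R).
Variables (m : nat) (S : m.-tuple (labeled X)).

Definition labeled_part : multiset (labeled X) := seq_mset S.
Definition unlabeled_part : multiset X := seq_mset [seq (z.1 : X) | z <- S].

Definition net_size (t : R) : nat := #|` Net unlabeled_part t|.

(* The set has finitely many elements, and some as soon as [1 < m]: the
   infimum is then a minimum. *)
Definition Gmin : R :=
  inf [set GB (min_sep labeled_part t) (net_size t) delta m 1
      | t in [set t | 0 < t /\ (net_size t < m)%N]].

End Gmin.

(* [subsample_prob D m l E] is the probability of [E S_in S_l] when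
   [S_in ~ D^m] and [S_l] is a sequence of [l] elements of [S_in] drawn
   uniformly without replacement, i.e., along a uniformly random injection [f]
   of the [l] positions into the [m] ones. Inner probability: the event may
   fail to be measurable, as learners and net procedures are arbitrary. *)
Definition subsample_prob (D : probability (labeled X) R) (m l : nat)
    (E : m.-tuple (labeled X) -> l.-tuple (labeled X) -> Prop) : R :=
  (\sum_(f : {ffun 'I_l -> 'I_m} | injectiveb f)
     inner_prob (iid D m) [set S | E S [tuple tnth S (f i) | i < l]])
  / #|[set f : {ffun 'I_l -> 'I_m} | injectiveb f]%SET|%:R.

End learning.

(* Main.v *)
(* The net is turned into one heavy point x0 and light points (all the others).
   Each light point has mass q ~ 1 / (sqrt m * polylog m) and an unknown
   deterministic label; x0 carries the remaining mass and is labelled false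
   with mass eta = 1 / sqrt m, which is the Bayes error.
   - A learner seeing l examples, l * q <= 1 / 2, misses on average at least
     half of the light points; flipping the label of a missed one does not change
     what the learner sees, so averaged over labellings, its error is a constant
     fraction of the light mass, 1 / polylog m, which dwarfs m^(-1/4).
   - By Chebyshev's inequality both labels of x0 occur of the order of
     m * eta = sqrt m times or more in S_in.  Separating them at any scale t > 0
     costs nu(t) >= eta / 2, while dropping the noise at the scale of the net
     costs at most 3/2 * eta.
   Hence some labelling works; the labellings share their marginal, so knowing
   it does not help the learner. *)
From HB Require Import structures.
Require Import Defs.
From mathcomp Require Import all_boot all_order all_algebra.
From mathcomp Require Import finmap multiset.
From mathcomp Require Import all_classical all_reals all_analysis.
From mathcomp Require Import ring lra.

Set Implicit Arguments.
Unset Strict Implicit.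
Unset Printing Implicit Defensive.

Import Order.TTheory GRing.Theory Num.Theory.
Import numFieldNormedType.Exports.

Local Open Scope classical_set_scope.
Local Open Scope ring_scope.

(** * Finite product distributions and concentration of counts *)

Section product_weight.
Context (R : realFieldType) (I : finType) (w : I -> R) (m : nat).
Hypothesis w_ge0 : forall i, 0 <= w i.
Hypothesis w_sum1 : \sum_i w i = 1.

(** A sample is described by the indices of its draws, so every expectation is a finite sum;
    [inner_prob_iid_discrete] carries the results over to [iid]. *)
Definition prodw (om : {ffun 'I_m -> I}) : R := \prod_j w (om j).

Definition expect (F : {ffun 'I_m -> I} -> R) : R := \sum_om prodw om * F om.

Lemma prodw_ge0 om : 0 <= prodw om.
Proof. exact: prodr_ge0. Qed.

(** Independence of the draws, through distributivity; setting most factors to 1 yields the moments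
    below. *)
Lemma expect_prod (g : 'I_m -> I -> R) :
  expect (fun om => \prod_j g j (om j)) = \prod_j \sum_i w i * g j i.
Proof.
rewrite bigA_distr_bigA; apply: eq_bigr => om _.
by rewrite /prodw big_split.
Qed.

Lemma expect_cst c : expect (fun=> c) = c.
Proof.
rewrite /expect -mulr_suml.
have := expect_prod (fun _ _ => 1).
rewrite /expect (eq_bigr prodw); last by move=> om _; rewrite big1// mulr1.
move=> ->; rewrite big1 ?mul1r// => j _.
by rewrite -[RHS]w_sum1; apply: eq_bigr => i _; rewrite mulr1.
Qed.

Lemma expectD F G : expect (fun om => F om + G om) = expect F + expect G.
Proof. by rewrite -big_split; apply: eq_bigr => om _; rewrite mulrDr. Qed.

Lemma expectZ c F : expect (fun om => c * F om) = c * expect F.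
Proof. by rewrite mulr_sumr; apply: eq_bigr => om _; rewrite mulrCA. Qed.

Lemma expect_sum (K : finType) (F : K -> {ffun 'I_m -> I} -> R) :
  expect (fun om => \sum_k F k om) = \sum_k expect (F k).
Proof.
by rewrite exchange_big; apply: eq_bigr => om _; rewrite mulr_sumr.
Qed.

Lemma le_expect F G : (forall om, F om <= G om) -> expect F <= expect G.
Proof. by move=> FG; apply: ler_sum => om _; rewrite ler_wpM2l// prodw_ge0. Qed.

Lemma expect1 j (g : I -> R) : expect (fun om => g (om j)) = \sum_i w i * g i.
Proof.
have := expect_prod (fun j' i => if j' == j then g i else 1).
rewrite (bigD1 j)//= eqxx [X in _ * X]big1 ?mulr1; last first.
  move=> j' /negPf ->; rewrite -[RHS]w_sum1.
  by apply: eq_bigr => i _; rewrite mulr1.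
move=> <-; apply: eq_bigr => om _; congr (_ * _).
by rewrite (bigD1 j)//= eqxx big1 ?mulr1// => j' /negPf ->.
Qed.

Lemma expect2 j1 j2 (g : I -> R) : j1 != j2 ->
  expect (fun om => g (om j1) * g (om j2)) = (\sum_i w i * g i) ^+ 2.
Proof.
move=> j12; have j21 : j2 != j1 by rewrite eq_sym.
have := expect_prod
  (fun j i => if j == j1 then g i else if j == j2 then g i else 1).
rewrite (bigD1 j1)//= eqxx (bigD1 j2)//= (negPf j21) eqxx.
rewrite [X in _ * (_ * X)]big1 ?mulr1; last first.
  move=> j /andP[/negPf -> /negPf ->]; rewrite -[RHS]w_sum1.
  by apply: eq_bigr => i _; rewrite mulr1.
rewrite -expr2 => <-; apply: eq_bigr => om _; congr (_ * _).
rewrite (bigD1 j1)//= eqxx (bigD1 j2)//= (negPf j21) eqxx.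
by rewrite big1 ?mulr1// => j /andP[/negPf -> /negPf ->].
Qed.

Definition count_idx (z : I) (om : {ffun 'I_m -> I}) : nat :=
  #|[set j | om j == z]%SET|.

(** The deviation is a sum of [m] independent centred indicators: cross terms vanish, and each
    square contributes [w z - w z ^+ 2]. *)
Lemma count_idx_variance z :
  expect (fun om => ((count_idx z om)%:R - m%:R * w z) ^+ 2) <= m%:R * w z.
Proof.
pose h i : R := (i == z)%:R - w z.
have Eh : \sum_i w i * h i = 0.
  under eq_bigr do rewrite mulrBr.
  rewrite sumrB -mulr_suml w_sum1 mul1r (bigD1 z)//= eqxx mulr1.
  by rewrite big1 ?addr0 ?subrr// => i /negPf ->; rewrite mulr0.
have Eh2 : \sum_i w i * (h i * h i) <= w z.
  have -> : \sum_i w i * (h i * h i) = \sum_i w i * (i == z)%:R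
      - w z * \sum_i w i * (i == z)%:R - w z * \sum_i w i * h i.
    rewrite !mulr_sumr -!sumrB; apply: eq_bigr => i _; rewrite /h.
    by case: (i == z) => /=; ring.
  rewrite Eh mulr0 subr0 (bigD1 z)//= eqxx mulr1 big1 ?addr0; last first.
    by move=> i /negPf ->; rewrite mulr0.
  by rewrite gerBl mulr_ge0.
have cE om : (count_idx z om)%:R - m%:R * w z = \sum_j h (om j).
  rewrite sumrB sumr_const card_ord mulr_natl /count_idx -sum1_card natr_sum.
  congr (_ - _); rewrite big_mkcond; apply: eq_bigr => j _.
  by rewrite inE; case: (om j == z).
have -> : expect (fun om => ((count_idx z om)%:R - m%:R * w z) ^+ 2)
   = \sum_j1 \sum_j2 expect (fun om => h (om j1) * h (om j2)).
  transitivity (expect (fun om => \sum_j1 \sum_j2 h (om j1) * h (om j2))).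
    apply: eq_bigr => om _; rewrite cE expr2 mulr_suml; congr (_ * _).
    by apply: eq_bigr => j _; rewrite mulr_sumr.
  by rewrite expect_sum; apply: eq_bigr => j _; rewrite expect_sum.
have -> : m%:R * w z = \sum_(j < m) w z.
  by rewrite sumr_const card_ord mulr_natl.
apply: ler_sum => j1 _; rewrite (bigD1 j1)//= big1 ?addr0.
  by rewrite (expect1 j1 (fun i => h i * h i)).
by move=> j2 j21; rewrite expect2 1?eq_sym// Eh expr0n.
Qed.

Lemma count_idx_chebyshev z : 0 < m%:R * w z ->
  expect (fun om => (m%:R * w z / 2 < `|(count_idx z om)%:R - m%:R * w z|)%R%:R)
  <= 4 / (m%:R * w z).
Proof.
set mu := m%:R * w z => mu_gt0; rewrite ler_pdivlMr// mulrC.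
rewrite -(ler_pM2l mu_gt0).
apply: (@le_trans _ _ (4 * expect (fun om => ((count_idx z om)%:R - mu) ^+ 2))).
  rewrite mulrA -!expectZ; apply: le_expect => om.
  case: ltP => [h|_] /=; last by rewrite mulr0 mulr_ge0// sqr_ge0.
  rewrite mulr1 -(@real_normK _ (_ - _)) ?num_real//.
  (* Hence a squared deviation of at least [mu ^+ 2 / 4], which the variance bound turns into
     [4 / mu]. *)
  have : 0 <= (`|(count_idx z om)%:R - mu| - mu / 2)
              * (`|(count_idx z om)%:R - mu| + mu / 2).
    by rewrite mulr_ge0 ?subr_ge0 ?(ltW h)// addr_ge0// divr_ge0// ltW.
  by nra.
by rewrite [mu * 4]mulrC ler_pM2l// count_idx_variance.
Qed.

End product_weight.

(** * Averaging over labellings *)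

Section no_free_lunch.
Context (R : realFieldType) (J : finType).

Definition flip (j : J) (sg : {ffun J -> bool}) : {ffun J -> bool} :=
  [ffun i => if i == j then ~~ sg i else sg i].

Lemma flipK j : involutive (flip j).
Proof.
move=> sg; apply/ffunP => i.
by rewrite !ffunE; case: eqP => // _; rewrite negbK.
Qed.

(* Flipping [sg j] turns right predictions at [j] into wrong ones. *)
Lemma sum_mistake (g : {ffun J -> bool} -> bool) j :
  (forall sg, g (flip j sg) = g sg) ->
  \sum_sg (g sg != sg j)%:R = #|{ffun J -> bool}|%:R / 2 :> R.
Proof.
move=> gflip; set s : R := \sum_sg _.
have sE : s = \sum_(sg : {ffun J -> bool}) (g sg == sg j)%:R.
  rewrite /s (reindex_inj (inv_inj (flipK j))); apply: eq_bigr => sg _.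
  by rewrite gflip ffunE eqxx; case: (g sg) (sg j) => [] [].
have : s + s = #|{ffun J -> bool}|%:R.
  rewrite {1}sE -big_split -sum1_card natr_sum; apply: eq_bigr => sg _.
  by case: eqP => _ /=; rewrite ?addr0 ?add0r.
by clearbody s; lra.
Qed.

Context (w : J + bool -> R) (q : R) (m l : nat) (f : 'I_l -> 'I_m).
Hypothesis w_ge0 : forall i, 0 <= w i.
Hypothesis w_sum1 : \sum_i w i = 1.
Hypothesis w_light : forall j, w (inl j) = q.
(** [g sg om j] is the prediction at the light point [j] under the labelling [sg], after the draws
    [om]; the learner reads only the positions [f i], hence [g_unseen]. *)
Context (g : {ffun J -> bool} -> {ffun 'I_m -> J + bool} -> J -> bool).
Hypothesis g_unseen : forall sg (om : {ffun 'I_m -> J + bool}) j,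
  (forall i, om (f i) != inl j) ->
  g (flip j sg) om j = g sg om j.

Definition mistakes sg om : nat := #|[set j | g sg om j != sg j]%SET|.

(** By a union bound, a light point escapes all [l] draws with probability at least [1 - l * q];
    once it does, half of the labellings contradict the prediction there. *)
Lemma expect_mistakes :
  #|{ffun J -> bool}|%:R * (#|J|%:R * (1 - l%:R * q) / 2)
  <= \sum_sg expect w (fun om => (mistakes sg om)%:R).
Proof.
set C : R := #|{ffun J -> bool}|%:R.
have -> : \sum_sg expect w (fun om => (mistakes sg om)%:R) =
    \sum_j expect w (fun om => \sum_sg (g sg om j != sg j)%:R).
  transitivity (\sum_sg \sum_j expect w (fun om => (g sg om j != sg j)%:R)).
    apply: eq_bigr => sg _.
    rewrite -(expect_sum w (fun j om => (g sg om j != sg j)%:R)).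
    apply: eq_bigr => om _; congr (_ * _).
    rewrite /mistakes -sum1_card natr_sum big_mkcond; apply: eq_bigr => j _.
    by rewrite inE; case: (_ != _).
  by rewrite exchange_big; apply: eq_bigr => j _; rewrite expect_sum.
have -> : C * (#|J|%:R * (1 - l%:R * q) / 2) =
    \sum_(j : J) C / 2 * (1 - l%:R * q).
  by rewrite sumr_const -mulr_natl; ring.
apply: ler_sum => j _.
(* The bracket is 1 if no draw hits [j] and at most 0 otherwise. *)
have -> : C / 2 * (1 - l%:R * q) =
    expect w (fun om => C / 2 * (1 + (-1) * \sum_i (om (f i) == inl j)%:R)).
  rewrite expectZ expectD expect_cst// expectZ expect_sum.
  under [X in _ = _ * (_ + -1 * X)]eq_bigr => i _.
    rewrite (expect1 w_sum1 (f i) (fun x => (x == inl j)%:R)).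
    rewrite (bigD1 (inl j))//= eqxx mulr1 big1 ?addr0 ?w_light.
      over.
    by move=> x /negPf ->; rewrite mulr0.
  by rewrite sumr_const card_ord mulN1r mulr_natl.
apply: le_expect => // om.
have [seen|/existsPn unseen] := boolP [exists i, om (f i) == inl j].
  apply: (@le_trans _ _ 0); last by apply: sumr_ge0.
  rewrite mulr_ge0_le0 ?divr_ge0// mulN1r subr_le0.
  case/existsP: seen => i si; rewrite (bigD1 i)//= si lerDl.
  exact: sumr_ge0.
rewrite (sum_mistake (g := fun sg => g sg om j)); last first.
  by move=> sg; apply: g_unseen.
rewrite ler_piMr ?divr_ge0// mulN1r big1 ?subr0// => i _.
by rewrite (negPf (unseen i)).
Qed.

(** Reverse Markov inequality: the fraction of mistakes is at most 1 and averages at least 1/4,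
    hence it reaches 1/8 with mean probability at least 1/8; discarding the failures of [G] leaves
    1/16. *)
Lemma exists_many_mistakes (G : pred {ffun 'I_m -> J + bool}) :
  (0 < #|J|)%N -> l%:R * q <= 1 / 2 ->
  expect w (fun om => (~~ G om)%:R) <= 1 / 16 ->
  #|{ffun J -> bool}|%:R * (1 / 16)
  <= \sum_sg expect w
       (fun om => (G om && (#|J| <= 8 * mistakes sg om)%N)%:R).
Proof.
move=> J_gt0 lq badG.
have J0 : 0 < #|J|%:R :> R by rewrite ltr0n.
have le_ind sg :
    expect w (fun om => (mistakes sg om)%:R) / #|J|%:R - 1 / 8 - 1 / 16
    <= expect w (fun om => (G om && (#|J| <= 8 * mistakes sg om)%N)%:R).
  apply: (@le_trans _ _ (expect w
     (fun om => #|J|%:R^-1 * (mistakes sg om)%:R +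
        (- (1 / 8) + -1 * (~~ G om)%:R)))).
    by rewrite expectD expectZ expectD expectZ expect_cst//; lra.
  apply: le_expect => // om.
  have : #|J|%:R^-1 * (mistakes sg om)%:R <= 1 :> R.
    by rewrite mulrC ler_pdivrMr// mul1r ler_nat max_card.
  case: (G om) => /=; last by lra.
  case: leqP => /=; first by lra.
  rewrite -(ltr_nat R) natrM => lt8 _.
  have : #|J|%:R^-1 * (mistakes sg om)%:R <= 1 / 8 :> R.
    by rewrite mulrC ler_pdivrMr//; lra.
  by lra.
apply: le_trans (ler_sum _ (fun sg _ => le_ind sg)).
rewrite !sumrB !sumr_const -mulr_suml.
rewrite -(mulr_natl (1 / 8)) -(mulr_natl (1 / 16)).
have := expect_mistakes; set C := #|{ffun J -> bool}|%:R : R.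
set s := \sum_sg _.
move=> les.
have : C / 4 <= s / #|J|%:R.
  rewrite ler_pdivlMr//; apply: le_trans les.
  have C0 : 0 <= C * #|J|%:R by rewrite mulr_ge0.
  have -> : C * (#|J|%:R * (1 - l%:R * q) / 2) =
      C * #|J|%:R * ((1 - l%:R * q) / 2).
    by ring.
  rewrite mulrAC ler_wpM2l//; lra.
by lra.
Qed.

End no_free_lunch.

(** * Finitely supported distributions *)

Section discrete_distribution.
Context d (Z : measurableType d) (R : realType) (I : finType).
Context (w : I -> R) (z : I -> Z).
Hypothesis w_ge0 : forall i, 0 <= w i.
Hypothesis w_sum1 : \sum_i w i = 1.
Implicit Type A : set Z.

Definition discrete A : \bar R := (\sum_i w i * (z i \in A)%:R)%:E.

(** [msum] reads a sequence of measures: the elements of [I] are enumerated, with the zero measure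
    past the last one. *)
Let atom (n : nat) : {measure set Z -> \bar R} :=
  if insub n is Some i then
    mscale (NngNum (w_ge0 (enum_val (i : 'I_#|I|)))) (dirac (z (enum_val i)))
  else mzero.

Let discreteE A : discrete A = msum atom #|I| A.
Proof.
rewrite /msum /discrete (reindex (@enum_val I predT)) /=; last first.
  exact/onW_bij/enum_val_bij.
rewrite -sumEFin; apply: eq_bigr => i _.
by rewrite /atom valK /= /mscale/= diracE.
Qed.

Let discrete0 : discrete set0 = 0%E.
Proof. by rewrite discreteE measure0. Qed.

Let discrete_ge0 A : (0 <= discrete A)%E.
Proof. by rewrite discreteE. Qed.

Let discrete_sigma_additive : semi_sigma_additive discrete.
Proof.
rewrite (_ : discrete = msum atom #|I|); last exact/funext/discreteE.
exact: measure_semi_sigma_additive.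
Qed.

HB.instance Definition _ := isMeasure.Build _ _ _ discrete
  discrete0 discrete_ge0 discrete_sigma_additive.

Let discrete_setT : discrete [set: Z] = 1%E.
Proof.
rewrite /discrete; under eq_bigr do rewrite in_setT mulr1.
by rewrite w_sum1.
Qed.

Definition discrete_prob : probability Z R :=
  HB.pack discrete (Measure_isProbability.Build _ _ _ discrete discrete_setT).

Lemma discrete_probE A :
  discrete_prob A = (\sum_i w i * (z i \in A)%:R)%:E.
Proof. by []. Qed.

End discrete_distribution.

(** A learner that knows the marginal takes a packed probability as argument, so equality of set
    functions is lifted to the whole structure; the other fields are proofs, identified by proof
    irrelevance. *)
Lemma eq_probability d (Z : measurableType d) (R : realType)
  (P Q : probability Z R) : P = Q :> (set Z -> \bar R) -> P = Q.
Proof.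
case: P Q => [P [[a b] [c] [e] [f] [g] [h] [i]]].
case=> [Q [[a' b'] [c'] [e'] [f'] [g'] [h'] [i']]] /= PQ; subst Q.
rewrite (Prop_irrelevance a' a).
move: c'; rewrite (Prop_irrelevance b' b) => c'.
rewrite (Prop_irrelevance c' c).
rewrite (Prop_irrelevance e' e) (Prop_irrelevance f' f).
rewrite (Prop_irrelevance g' g) (Prop_irrelevance h' h).
by rewrite (Prop_irrelevance i' i).
Qed.

(** * Inner probability of events on i.i.d. samples *)

Lemma preimage_tuple_cons d (Z : measurableType d) n (z : Z) (t : n.-tuple Z) :
  @tuple_cons _ Z n @^-1` [set [tuple of z :: t]] = [set z] `*` [set t].
Proof.
apply/seteqP; split => [[y u]|[y u] [/= -> ->//]].
by move=> /(congr1 val)/= [-> /val_inj ->].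
Qed.

Section inner_prob.
Context d (Z : measurableType d) (R : realType) (P : probability Z R).
Implicit Types A B : set Z.

Let inner_fin A :
  ereal_sup [set P C | C in [set C | measurable C /\ C `<=` A]] \is a fin_num.
Proof.
rewrite ge0_fin_numE.
  apply: (@le_lt_trans _ _ 1%E); last exact: ltry.
  by apply: ge_ereal_sup => _ [C [mC _] <-]; exact: probability_le1.
apply: le_trans (ereal_sup_ubound _); last by exists set0; [split|].
by rewrite measure0.
Qed.

Lemma le_inner_prob A B : A `<=` B -> inner_prob P A <= inner_prob P B.
Proof.
move=> AB; apply: fine_le => //; apply: ge_ereal_sup => _ [C [mC CA] <-].
apply: ereal_sup_ubound; exists C => //; split=> //.
exact: subset_trans CA AB.
Qed.

End inner_prob.

Section iid_discrete.
Context d (Z : measurableType d) (R : realType).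
Hypothesis measurable_point : forall y : Z, measurable [set y].

Lemma measurable_tuple1 n (t : n.-tuple Z) : measurable [set t].
Proof.
rewrite (_ : [set t] = \bigcap_(i in [set` index_enum 'I_n])
    ((@tnth _ Z ^~ i) @^-1` [set tnth t i])).
  rewrite bigcap_seq; apply: bigsetI_measurable => i _.
  by rewrite -[X in measurable X]setTI; exact: measurable_tnth.
apply/seteqP; split => [_ -> //|u tu].
by apply/eq_from_tnth => i; apply: tu; rewrite /= mem_index_enum.
Qed.

Lemma iid_tuple1 (P : probability Z R) n (t : n.-tuple Z) :
  iid P n [set t] = (\prod_(j < n) fine (P [set tnth t j]))%:E.
Proof.
elim: n t => [|n IHn] t.
  by rewrite big_ord0 tuple0 /= diracE mem_set.
case/tupleP: t => y t.
rewrite /= /distribution /pushforward preimage_tuple_cons.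
rewrite product_measure1E//; last first.
  exact: measurable_tuple1.
transitivity (P [set y] * (\prod_(j < n) fine (P [set tnth t j]))%:E)%E.
  by congr (_ * _)%E; exact: IHn.
rewrite big_ord_recl tnth0 EFinM fineK ?fin_num_measure//.
by congr (_ * (_)%:E)%E; apply: eq_bigr => i _; rewrite tnthS.
Qed.

Context (I : finType) (w : I -> R) (z : I -> Z).
Hypothesis w_ge0 : forall i, 0 <= w i.
Hypothesis w_sum1 : \sum_i w i = 1.
Hypothesis z_inj : injective z.

(** The event [E] may fail to be measurable, but the outcomes in [B] give a finite, hence
    measurable, set of tuples inside it. As [z] is injective, distinct outcomes are distinct atoms,
    of mass [prodw]. *)
Lemma inner_prob_iid_discrete m (E : set (m.-tuple Z))
  (B : pred {ffun 'I_m -> I}) :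
  (forall om, B om -> E [tuple z (om j) | j < m]) ->
  expect w (fun om => (B om)%:R)
  <= inner_prob (iid (discrete_prob z w_ge0 w_sum1) m) E.
Proof.
move=> BE; set P := discrete_prob _ _ _.
pose s (om : {ffun 'I_m -> I}) := [tuple z (om j) | j < m].
have s_inj : injective s.
  move=> om1 om2 /(congr1 (fun t => tnth t)) e; apply/ffunP => j.
  by apply: z_inj; move: (congr1 (fun t => t j) e); rewrite !tnth_mktuple.
pose S := \bigcup_(om in [set` enum B]) [set s om].
have mS : measurable S.
  rewrite /S bigcup_seq; apply: bigsetU_measurable => om _.
  exact: measurable_tuple1.
have PS : iid P m S = (expect w (fun om => (B om)%:R))%:E.
  rewrite measure_fin_bigcup; first last.
  - by move=> om _; exact: measurable_tuple1.
  - by move=> om1 om2 _ _ [t [/= -> /s_inj]].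
  - exact: finite_seq.
  - rewrite -fsbig_seq ?enum_uniq// big_enum_cond/= /expect -sumEFin.
    rewrite big_mkcond/=; apply: eq_bigr => om _.
    rewrite andbT unfold_in; case: (B om); last by rewrite mulr0.
    rewrite mulr1 iid_tuple1; congr EFin; apply: eq_bigr => j _.
    rewrite tnth_mktuple discrete_probE /= (bigD1 (om j))//= mem_set// mulr1.
    rewrite big1 ?addr0// => i /eqP ij.
    by rewrite memNset ?mulr0// => /z_inj.
have SE : S `<=` E.
  by move=> _ [om + ->]; rewrite /= mem_enum => Bom; exact: BE.
apply: le_trans (le_inner_prob _ SE).
by rewrite inner_prob_measurable// PS.
Qed.

End iid_discrete.

(** * Measurability of singletons *)

Lemma measurable_borel1 (R : realType) (X : pmetricType R) (x : borel X) :
  measurable [set x].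
Proof.
rewrite -[X in measurable X]setCK.
apply: measurableC; apply: sub_sigma_algebra; rewrite /= openC.
exact/accessible_closed_set1/hausdorff_accessible/metric_hausdorff.
Qed.

Lemma measurable_labeled1 (R : realType) (X : pmetricType R) (z : labeled X) :
  measurable [set z].
Proof.
case: z => x b; rewrite (_ : [set (x, b)] = [set x] `*` [set b]); last first.
  by apply/seteqP; split => [_ -> //|[y c] [/= -> ->]].
by apply: measurableX => //; exact: measurable_borel1.
Qed.

(** * Separating the labels of a sample *)

Section separation.
Context (R : realType) (X : pmetricType R).
Implicit Types (S : multiset (labeled X)) (t nu : R).

Lemma size_seq_mset (K : choiceType) (s : seq K) : size (seq_mset s) = size s.
Proof. exact/perm_size/perm_eq_seq_mset. Qed.

Lemma le_size_mset (K : choiceType) (A : multiset K) a : (A a <= size A)%N.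
Proof. by rewrite -count_mem_mset count_size. Qed.

(** Examples at [x] with opposite labels are at distance 0, less than [t], so one of the labels
    disappears at [x], at the cost of at least [c] removals. *)
Lemma label_separated_conflict S nu t (x : X) c : 0 < t ->
  (forall b, c <= (S (x, b))%:R) -> label_separated S nu t ->
  c <= nu * (size S)%:R.
Proof.
move=> t0 cS [S' [_ le_nu sep]]; apply: le_trans le_nu.
have [b xb] : exists b, S' (x, b) = 0%N.
  have [z1|] := boolP ((x, true) \in S'); last first.
    by move=> /mset_eq0P; exists true.
  exists false; apply/mset_eq0P/negP => z2.
  by have := sep _ _ z1 z2 isT; rewrite mdistxx leNgt t0.
apply: le_trans (cS b) _; rewrite ler_nat.
by apply: leq_trans (le_size_mset _ (x, b)); rewrite msetE2 xb subn0.
Qed.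

Lemma label_separated1 S t : label_separated S 1 t.
Proof.
exists mset0; split; [exact: msub0set | | by move=> z z'; rewrite in_mset0].
by rewrite msetB0 mul1r.
Qed.

Lemma le_min_sep S t (x : X) c : 0 < t -> (0 < size S)%N ->
  (forall b, c * (size S)%:R <= (S (x, b))%:R) -> c <= min_sep S t.
Proof.
move=> t0 S0 cS; apply: lb_le_inf; first by exists 1; exact: label_separated1.
move=> nu /(label_separated_conflict t0 cS).
by rewrite ler_pM2r// ltr0n.
Qed.

Lemma min_sep_le S t (z1 : labeled X) nu : (0 < size S)%N ->
  (forall z z', z \in S -> z' \in S -> z != z1 -> z' != z1 -> z.2 != z'.2 ->
     t <= mdist (z.1 : X) (z'.1 : X)) ->
  (S z1)%:R <= nu * (size S)%:R -> min_sep S t <= nu.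
Proof.
move=> S0 sep le_nu; apply: ge_inf.
  exists 0 => y [S' [_ ley _]].
  rewrite -(pmulr_lge0 (x := (size S)%:R)) ?ltr0n//.
  exact: le_trans ley.
have S'E z : seq_mset [seq z <- S | z != z1] z = if z == z1 then 0%N else S z.
  rewrite mset_seqE count_filter -count_mem_mset.
  case: eqP => [->|/eqP zz1].
    rewrite -(count_pred0 S); apply: eq_count => y /=.
    by case: eqP.
  apply: eq_count => y /=; case: eqP => //= ->.
  by rewrite zz1.
exists (seq_mset [seq z <- S | z != z1]); split.
- by apply/msubsetP => z; rewrite S'E; case: ifP.
- suff -> : (S `\` seq_mset [seq z <- S | z != z1])%mset = msetn (S z1) z1.
    by rewrite enum_msetn size_nseq.
  apply/msetP => z; rewrite msetE2 S'E msetnE.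
  by case: eqP => [->|_]; rewrite ?subn0 ?subnn.
- move=> z z'; rewrite !in_mset !S'E.
  case: ifP => // /negbT zz1; case: ifP => // /negbT z'z1.
  by rewrite !mset_gt0 => zS z'S; apply: sep.
Qed.

End separation.

(** * Lower and upper estimates of [GB] *)

Section generalization_bound.
Context (R : realType).
Implicit Types (eps delta : R) (N m : nat).

Lemma ln_inv_ge0 delta : 0 < delta < 1 -> 0 <= ln (delta^-1).
Proof.
by case/andP => d0 d1; rewrite ln_ge0// ltW// invf_gt1.
Qed.

Lemma ln_nat_ge0 m : 0 <= ln m%:R :> R.
Proof.
by case: m => [|m]; [rewrite ln0|rewrite ln_ge0// ler1n].
Qed.

Lemma GB_ge eps N delta m : 0 < delta < 1 -> 0 <= eps -> (N < m)%N ->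
  eps <= GB eps N delta m 1.
Proof.
move=> d01 e0 Nm; rewrite /GB muln1.
have mN : 0 < m%:R - N%:R :> R by rewrite subr_gt0 ltr_nat.
have c0 : 0 <= N.+1%:R * ln m%:R + ln (delta^-1).
  by rewrite addr_ge0 ?ln_inv_ge0// mulr_ge0// ln_nat_ge0.
rewrite -addrA; apply: (@le_trans _ _ (m%:R / (m%:R - N%:R) * eps)).
  by rewrite ler_peMl// ler_pdivlMr// mul1r gerBl.
by rewrite lerDl addr_ge0// mulr_ge0// divr_ge0// ltW.
Qed.

(** As [N] is at most [m / 2], both [alpha <= 2] and [1 / (m - N) <= 2 / m]. With [cm = c / m], the
    square root is at most [eps + cm] by the arithmetic-geometric mean inequality; the coefficients
    2 + 3 and 4/3 + 3 are at most 5. *)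
Lemma GB_le eps N delta m : 0 < delta < 1 -> 0 <= eps -> (0 < m)%N ->
  (2 * N <= m)%N ->
  GB eps N delta m 1 <= 5 * (eps + (N.+1%:R * ln m%:R + ln (delta^-1)) / m%:R).
Proof.
move=> d01 e0 m0 Nm; rewrite /GB muln1.
set c := N.+1%:R * ln m%:R + ln (delta^-1).
have c0 : 0 <= c by rewrite addr_ge0 ?ln_inv_ge0// mulr_ge0// ln_nat_ge0.
have m0' : 0 < m%:R :> R by rewrite ltr0n.
have Nm' : 2 * N%:R <= m%:R :> R by rewrite -natrM ler_nat.
have mN : 0 < m%:R - N%:R :> R by have : 0 <= N%:R :> R by []; lra.
have inv : (m%:R - N%:R)^-1 <= 2 / m%:R :> R.
  by rewrite -[X in X <= _]mul1r ler_pdivrMr// mulrAC ler_pdivlMr//; lra.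
set cm := c / m%:R; have cm0 : 0 <= cm by rewrite divr_ge0// ltW.
have alpha2 : m%:R / (m%:R - N%:R) <= 2 :> R.
  by rewrite ler_pdivrMr//; lra.
have alpha0 : 0 <= m%:R / (m%:R - N%:R) :> R by rewrite divr_ge0// ltW.
have cmN : c / (m%:R - N%:R) <= 2 * cm.
  by rewrite /cm mulrCA ler_wpM2l.
have cmN0 : 0 <= c / (m%:R - N%:R) by rewrite divr_ge0// ltW.
have t1 : m%:R / (m%:R - N%:R) * eps <= 2 * eps by rewrite ler_wpM2r.
have t3 : Num.sqrt (m%:R / (m%:R - N%:R) * eps * c / (m%:R - N%:R)) <= eps + cm.
  rewrite -[X in _ <= X]ger0_norm ?addr_ge0// -sqrtr_sqr ler_wsqrtr//.
  rewrite -mulrA; apply: (@le_trans _ _ ((2 * eps) * (2 * cm))).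
    by rewrite ler_pM// mulr_ge0.
  by have := sqr_ge0 (eps - cm); nra.
have s2 : 3 / Num.sqrt 2 <= 3 :> R.
  rewrite ler_pdivrMr ?sqrtr_gt0// ler_peMr//.
  by rewrite -[X in X <= _]sqrtr1 ler_sqrt// ler1n.
have t3' : 3 / Num.sqrt 2 * Num.sqrt
    (m%:R / (m%:R - N%:R) * eps * c / (m%:R - N%:R)) <= 3 * (eps + cm).
  by rewrite ler_pM// divr_ge0// sqrtr_ge0.
by lra.
Qed.

End generalization_bound.

(** * The family of hard distributions *)

Lemma exists_ge_mean (R : realFieldType) (K : finType) (F : K -> R) c :
  (0 < #|K|)%N -> #|K|%:R * c <= \sum_k F k -> exists k, c <= F k.
Proof.
move=> K0 cF; apply: contrapT => /forallNP Fc; move: cF; apply/negP.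
rewrite -ltNge mulr_natl -sumr_const; apply: ltr_sum.
  by case/card_gt0P: K0 => k _; apply/hasP; exists k; rewrite ?mem_index_enum.
by move=> k _; rewrite ltNge; apply/negP/Fc.
Qed.

Section hard_distribution.
Context (R : realType) (X : pmetricType R) (J : finType) (x0 : X) (pt : J -> X).
Context (eta q : R).
Hypothesis pt_inj : injective pt.
Hypothesis pt_neq : forall j, pt j != x0.
Hypothesis q_ge0 : 0 <= q.
Hypothesis eta_gt0 : 0 < eta.
(** At [x0] the label true is at least as heavy as false: the noise is the minority label, and both
    labels have mass at least [eta]. *)
Hypothesis eta_le : eta <= 1 - eta - #|J|%:R * q.

(* [inl j] is the light point [pt j], [inr b] is [x0] with label [b]. *)
Let I : finType := (J + bool)%type.

Definition weight (i : I) : R :=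
  match i with
  | inl _ => q
  | inr b => if b then 1 - eta - #|J|%:R * q else eta
  end.

Definition place (i : I) : X := if i is inl j then pt j else x0.

Definition label (sg : {ffun J -> bool}) (i : I) : bool :=
  match i with inl j => sg j | inr b => b end.

Definition example (sg : {ffun J -> bool}) (i : I) : labeled X :=
  (place i, label sg i).

Lemma eta_le_weight b : eta <= weight (inr b).
Proof. by case: b. Qed.

Lemma weight_ge0 i : 0 <= weight i.
Proof.
by case: i => [j|b]//; apply: le_trans (eta_le_weight b); exact: ltW.
Qed.

Lemma sum_index (F : I -> R) :
  \sum_i F i = \sum_j F (inl j) + (F (inr true) + F (inr false)).
Proof. by rewrite big_sumType/= big_bool. Qed.

Lemma weight_sum1 : \sum_i weight i = 1.
Proof. by rewrite sum_index/= sumr_const -mulr_natl; ring. Qed.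

Lemma example_inj sg : injective (example sg).
Proof.
case=> [j|b] [j'|b'] []//= => [/pt_inj -> //|e|e|-> //].
  by move: (pt_neq j); rewrite e eqxx.
by move: (pt_neq j'); rewrite e eqxx.
Qed.

Definition hard sg : probability (labeled X) R :=
  discrete_prob (example sg) weight_ge0 weight_sum1.

Lemma marginal_hard sg sg' : marginal (hard sg) = marginal (hard sg').
Proof. exact/eq_probability/funext. Qed.

Lemma err_hard (h : X -> bool) (sg : {ffun J -> bool}) :
  err h (hard sg) = \sum_i weight i * (h (place i) != label sg i)%:R.
Proof.
rewrite /err discrete_probE /=; apply: eq_bigr => i _; congr (_ * _).
by congr (nat_of_bool _)%:R; apply/idP/idP; rewrite in_setE.
Qed.

(** At [x0] every classifier errs on one of the two labels, and each has mass at least [eta]. *)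
Lemma eta_le_err (h : X -> bool) (sg : {ffun J -> bool}) :
  eta <= err h (hard sg).
Proof.
rewrite err_hard (bigD1 (inr (~~ h x0)))//= -[X in X <= _]addr0 lerD//.
  rewrite (_ : (h x0 != ~~ h x0) = true) ?mulr1; first by case: (h x0).
  by case: (h x0).
by apply: sumr_ge0 => i _; rewrite mulr_ge0// weight_ge0.
Qed.

Lemma err_hard_ge (h : X -> bool) (sg : {ffun J -> bool}) :
  q * #|[set j | h (pt j) != sg j]%SET|%:R <= err h (hard sg).
Proof.
rewrite err_hard sum_index -[X in X <= _]addr0 lerD//; last first.
  by rewrite addr_ge0// mulr_ge0// weight_ge0.
rewrite -sum1_card natr_sum mulr_sumr big_mkcond /=.
by apply: ler_sum => j _; rewrite inE; case: (_ != _) => //=; rewrite mulr0.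
Qed.

Lemma bayes_error_hard sg : bayes_error (hard sg) = eta.
Proof.
(* The Bayes classifier: true exactly at the finitely many points that can carry the label true,
   [x0] included. Finiteness makes it measurable, and it errs only on [inr false]. *)
pose f (x : borel X) := [exists i, (place i == x) && label sg i].
have mf : measurable_fun setT f.
  apply: (measurable_fun_bool true); rewrite setTI.
  rewrite (_ : _ @^-1` _ = \big[setU/set0]_(i | label sg i) [set place i]).
    by apply: bigsetU_measurable => i _; exact: measurable_borel1.
  rewrite -bigcup_seq_cond; apply/seteqP; split => x /=.
    case/existsP => i /andP[/eqP <- li].
    by exists i => //=; rewrite mem_index_enum.
  case=> i /= /andP[_ li ->]; apply/existsP; exists i.
  by rewrite eqxx.
pose h : classifier X := HB.pack f (isMeasurableFun.Build _ _ _ _ f mf).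
have herr : err h (hard sg) = eta.
  have hx0 : f x0 by apply/existsP; exists (inr true); rewrite /= eqxx.
  have hpt j : f (pt j) = sg j.
    apply/existsP/idP => [[[j'|b]]/= /andP[/eqP e]|sj].
    - by rewrite (pt_inj e).
    - by move: (pt_neq j); rewrite e eqxx.
    - by exists (inl j); rewrite /= eqxx.
  rewrite err_hard sum_index /= big1 => [|j _].
    by rewrite hx0 /= mulr0 !add0r mulr1.
  by rewrite hpt eqxx mulr0.
apply/eqP; rewrite eq_le; apply/andP; split.
  rewrite -herr; apply: ge_inf; last by exists h.
  by exists eta => _ [g _ <-]; exact: eta_le_err.
apply: lb_le_inf; first by exists (err h (hard sg)), h.
by move=> _ [g _ <-]; exact: eta_le_err.
Qed.

Definition sample (sg : {ffun J -> bool}) m (om : {ffun 'I_m -> I}) :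
    m.-tuple (labeled X) :=
  [tuple example sg (om j) | j < m].

Lemma sample_labels sg m (om : {ffun 'I_m -> I}) z :
  z \in labeled_part (sample sg om) -> exists i, z = example sg i.
Proof.
rewrite in_mset mset_seqE -has_count has_pred1.
by case/mapP => j _ ->; exists (om j).
Qed.

Lemma sample_count sg m (om : {ffun 'I_m -> I}) b :
  labeled_part (sample sg om) (x0, b) = count_idx (inr b) om.
Proof.
rewrite mset_seqE /count_idx -sum1_card -sum1_count big_map big_enum_cond/=.
apply: eq_bigl => j; rewrite inE -(inj_eq (@example_inj sg)).
by [].
Qed.

(** * Typical samples and the value of [Gmin] *)

Context (Net : multiset X -> R -> {fset X}) (t0 delta : R).
Hypothesis NetP : is_net_procedure Net.
Hypothesis t0_gt0 : 0 < t0.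
Hypothesis place_sep : forall i i', place i != place i' ->
  t0 <= mdist (place i) (place i').
Hypothesis delta01 : 0 < delta < 1.

Lemma net_size_sample sg m (om : {ffun 'I_m -> I}) :
  (net_size Net (sample sg om) t0 <= #|J|.+1)%N.
Proof.
have [NetU _ _] := NetP (unlabeled_part (sample sg om)) t0_gt0.
rewrite -(size_codom pt) -[_.+1]/(size (x0 :: codom pt)).
apply: uniq_leq_size => [|x /NetU /=]; first exact: fset_uniq.
rewrite in_mset mset_seqE -has_count has_pred1 => /mapP[z zS ->].
case/mapP: zS => j _ -> /=; rewrite /example /= inE.
case: (om j) => [j'|b] /=; last by rewrite eqxx.
by rewrite orbC codom_f.
Qed.

Definition typical m (om : {ffun 'I_m -> I}) : bool :=
  [forall b, `|(count_idx (inr b) om)%:R - m%:R * weight (inr b)|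
             <= m%:R * weight (inr b) / 2].

(** With means of at least 128, Chebyshev's inequality bounds the failure of each of the two labels
    by 4/128 = 1/32. *)
Lemma typical_prob m : 128 <= m%:R * eta ->
  expect weight (fun om : {ffun 'I_m -> I} => (~~ typical om)%:R) <= 1 / 16.
Proof.
move=> m_eta.
have mw b : m%:R * eta <= m%:R * weight (inr b).
  by rewrite ler_wpM2l// eta_le_weight.
have mw_gt0 b : 0 < m%:R * weight (inr b).
  by apply: lt_le_trans (mw b); apply: lt_le_trans m_eta.
have cheb b : expect weight (fun om : {ffun 'I_m -> I} =>
    (m%:R * weight (inr b) / 2
     < `|(count_idx (inr b) om)%:R - m%:R * weight (inr b)|)%R%:R)
    <= 1 / 32.
  apply: le_trans (count_idx_chebyshev weight_ge0 weight_sum1 (mw_gt0 b)) _.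
  rewrite ler_pdivrMr//; apply: (@le_trans _ _ (1 / 32 * 128)); first by lra.
  by rewrite ler_pM2l//; apply: le_trans (mw b).
have -> : 1 / 16 = 1 / 32 + 1 / 32 :> R by lra.
apply: le_trans (lerD (cheb true) (cheb false)); rewrite -expectD.
apply: le_expect => [|om]; first exact: weight_ge0.
rewrite -natrD ler_nat negb_forall.
case: existsP => // -[b]; rewrite -ltNge.
by case: b => ->; rewrite ?addn1 ?add1n.
Qed.

Section gmin.
Context (sg : {ffun J -> bool}) (m : nat) (om : {ffun 'I_m -> I}).
Hypothesis m_gt0 : (0 < m)%N.
Hypothesis om_typical : typical om.

Let size_S : size (labeled_part (sample sg om)) = m.
Proof. by rewrite size_seq_mset size_tuple. Qed.

Let size_S_gt0 : (0 < size (labeled_part (sample sg om)))%N.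
Proof. by rewrite size_S. Qed.

(** Both labels occur at least [m * eta / 2] times at the single point [x0], a conflict present at
    every scale. *)
Lemma min_sep_sample_ge t : 0 < t ->
  eta / 2 <= min_sep (labeled_part (sample sg om)) t.
Proof.
move=> t_gt0; apply: (le_min_sep (x := x0)) => // b.
rewrite sample_count size_S.
have /forallP/(_ b) := om_typical; rewrite ler_norml => /andP[+ _].
have : m%:R * eta <= m%:R * weight (inr b) by rewrite ler_wpM2l// eta_le_weight.
by lra.
Qed.

(** Once the noise [(x0, false)] is dropped, the label is a function of the place, and distinct
    places are at least [t0] apart. *)
Lemma min_sep_sample_le :
  min_sep (labeled_part (sample sg om)) t0 <= 3 / 2 * eta.
Proof.
apply: (min_sep_le (z1 := (x0, false))) => //.
  move=> z z' /sample_labels[i ->] /sample_labels[i' ->] /= ne ne' ll.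
  apply: place_sep; apply: contra ll => /eqP.
  case: i i' ne ne' => [j|[]] [j'|[]] //=; rewrite ?eqxx// => _ _.
  - by move=> /pt_inj ->.
  - by move=> e; move: (pt_neq j); rewrite e eqxx.
  - by move=> e; move: (pt_neq j'); rewrite e eqxx.
rewrite sample_count size_S.
have /forallP/(_ false) := om_typical; rewrite ler_norml => /andP[_] /=.
by lra.
Qed.

Hypothesis J_small : (2 * #|J|.+1 <= m)%N.

(** Keeps the infimum in [Gmin] from being taken over the empty set, and provides the scale for its
    upper bound. *)
Let t0_admissible : 0 < t0 /\ (net_size Net (sample sg om) t0 < m)%N.
Proof.
split=> //; apply: leq_ltn_trans (net_size_sample _ _) _.
by apply: leq_trans J_small; rewrite mul2n -addnn -addn1 leq_add2l.
Qed.

Lemma Gmin_sample_ge : eta / 2 <= Gmin Net delta (sample sg om).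
Proof.
apply: lb_le_inf; first by eexists; exists t0; [exact: t0_admissible|].
move=> _ [t [t_gt0 Nt] <-].
apply: le_trans (min_sep_sample_ge t_gt0) _; apply: GB_ge => //.
by apply: le_trans (min_sep_sample_ge t_gt0); rewrite divr_ge0// ltW.
Qed.

Lemma Gmin_sample_le : Gmin Net delta (sample sg om) <=
  5 * (3 / 2 * eta + (#|J|.+2%:R * ln m%:R + ln (delta^-1)) / m%:R).
Proof.
have msep_ge t : 0 < t -> 0 <= min_sep (labeled_part (sample sg om)) t.
  move=> t_gt0; apply: le_trans (min_sep_sample_ge t_gt0).
  by rewrite divr_ge0// ltW.
apply: (@le_trans _ _ (GB (min_sep (labeled_part (sample sg om)) t0)
    (net_size Net (sample sg om) t0) delta m 1)).
  apply: ge_inf; last by exists t0.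
  exists 0 => _ [t [t_gt0 Nt] <-].
  by apply: le_trans (GB_ge _ _ Nt) => //; exact: msep_ge.
apply: le_trans (GB_le delta01 (msep_ge _ t0_gt0) m_gt0 _) _.
  by apply: leq_trans J_small; rewrite leq_mul2l net_size_sample.
rewrite ler_pM2l// lerD ?min_sep_sample_le//.
rewrite ler_pM2r ?invr_gt0 ?ltr0n// lerD2r ler_wpM2r ?ln_nat_ge0//.
by rewrite ler_nat ltnS net_size_sample.
Qed.

End gmin.

Theorem hard_labelling m l (A : learner X) :
  (0 < #|J|)%N -> (2 * #|J|.+1 <= m)%N -> (l <= m)%N ->
  l%:R * q <= 1 / 2 -> 128 <= m%:R * eta ->
  exists sg, 1 / 16 <= subsample_prob (hard sg)
    (fun (S_in : m.-tuple (labeled X)) (S_l : l.-tuple (labeled X)) =>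
      q * (#|J|%:R / 8) <= err (A S_l) (hard sg) /\
      eta / 2 <= Gmin Net delta S_in <=
      5 * (3 / 2 * eta + (#|J|.+2%:R * ln m%:R + ln (delta^-1)) / m%:R)).
Proof.
move=> J_gt0 J_small lm lq m_eta.
have m_gt0 : (0 < m)%N by apply: leq_trans J_small; rewrite muln_gt0.
(* The mean over labellings is bounded for each injection [f] separately, after the exchange of
   sums; the labelling obtained serves the average over all [f]. *)
apply: exists_ge_mean; first by apply/card_gt0P; exists [ffun=> true].
rewrite -mulr_suml exchange_big /=.
set inj := [set f : {ffun 'I_l -> 'I_m} | injectiveb f]%SET.
have inj_gt0 : (0 < #|inj|)%N.
  apply/card_gt0P; exists [ffun i => widen_ord lm i]; rewrite inE.
  apply/injectiveP => i i'; rewrite !ffunE => /(congr1 val) /= ?.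
  exact: val_inj.
rewrite ler_pdivlMr ?ltr0n//; set c := _ * (1 / 16).
have -> : c * #|inj|%:R = \sum_(f : {ffun 'I_l -> 'I_m} | injectiveb f) c.
  by rewrite sumr_const mulr_natr cardsE.
apply: ler_sum => f _; rewrite {}/c.
pose g sg (om : {ffun 'I_m -> I}) j :=
  A [tuple tnth (sample sg om) (f i) | i < l] (pt j).
(* The examples handed to the learner carry no label of an unseen point, so the flip leaves them
   unchanged. *)
have g_unseen sg (om : {ffun 'I_m -> I}) j : (forall i, om (f i) != inl j) ->
    g (flip j sg) om j = g sg om j.
  move=> unseen; rewrite /g; congr (A (tval _) _).
  apply: eq_from_tnth => i; rewrite !tnth_mktuple /example; congr (_, _).
  move: (unseen i); case: (om (f i)) => //= j' jj'; rewrite ffunE.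
  by rewrite ifN.
have := exists_many_mistakes (q := q) weight_ge0 weight_sum1 (fun=> erefl)
  g_unseen J_gt0 lq (typical_prob m_eta).
move=> /le_trans; apply; apply: ler_sum => sg _.
apply: inner_prob_iid_discrete.
- exact: measurable_labeled1.
- exact: example_inj.
move=> om /andP[om_typical many]; split; last first.
  by rewrite Gmin_sample_ge// Gmin_sample_le.
apply: le_trans (err_hard_ge _ sg); rewrite ler_wpM2l//.
by rewrite ler_pdivrMr// -natrM ler_nat mulnC.
Qed.

End hard_distribution.

(** * Estimates for large [m] *)

(** Write [m = y ^+ r]. Then [ln m = r * ln y <= r * y], so the left side is at most
    [c * r ^+ p * y ^+ p], while [sqrt m = y ^+ p.+1]; the hypothesis says that
    [c * r ^+ p <= y]. *)
Lemma ln_exp_le_sqrt (R : realType) (p m : nat) (c : R) : 0 <= c ->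
  (0 < m)%N -> (c * (2 * p.+1)%:R ^+ p) ^+ (2 * p.+1) <= m%:R ->
  c * ln m%:R ^+ p <= Num.sqrt m%:R.
Proof.
move=> c_ge0 m_gt0; set r := (2 * p.+1)%N => Km.
have r_gt0 : (0 < r)%N by rewrite muln_gt0.
have r_neq0 : r%:R != 0 :> R by rewrite pnatr_eq0 -lt0n.
have m_gt0' : 0 < m%:R :> R by rewrite ltr0n.
pose y : R := expR (ln m%:R / r%:R).
have y_gt0 : 0 < y by exact: expR_gt0.
have yr : y ^+ r = m%:R by rewrite -expRM_natl mulrC divfK// lnK// posrE.
have lny : ln m%:R = r%:R * ln y by rewrite expRK mulrC divfK.
have -> : Num.sqrt m%:R = y ^+ p.+1.
  by rewrite -yr /r mulnC exprM sqrtr_sqr ger0_norm// exprn_ge0// ltW.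
have Ky : c * r%:R ^+ p <= y.
  rewrite -(ler_pXn2r r_gt0) ?yr// nnegrE ?(ltW y_gt0)//.
  by rewrite mulr_ge0// exprn_ge0.
have ln_y : ln y <= y by rewrite ltW// ln_sublinear.
have ln_ge0 : 0 <= ln m%:R :> R by exact: ln_nat_ge0.
apply: (@le_trans _ _ (c * (r%:R * y) ^+ p)).
  rewrite ler_wpM2l// lerXn2r ?nnegrE ?mulr_ge0 ?(ltW y_gt0)//.
  by rewrite lny ler_wpM2l.
by rewrite exprMn mulrA exprS ler_wpM2r// exprn_ge0// ltW.
Qed.

Lemma sqr_le_sqrt (R : rcfType) (c x : R) : 0 <= c -> c ^+ 2 <= x ->
  c <= Num.sqrt x.
Proof. by move=> c0 cx; rewrite -(ger0_norm c0) -sqrtr_sqr ler_wsqrtr. Qed.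

(** In order, the bounds serve to compare powers of [ln m], to apply Chebyshev's inequality, to keep
    the net within [m / 2] points, to give it at least two points, and to ensure [l <= m]. *)
Lemma eventually_large (R : realType) (p : nat) (a b b' : R) :
  0 < a -> 0 < b -> 0 < b' ->
  exists m0 : nat, forall m : nat, (0 < m)%N -> (m0 <= m)%N ->
    [/\ 1 <= ln m%:R :> R, 128 <= Num.sqrt m%:R :> R, 2 * b <= Num.sqrt m%:R,
        2 <= a * Num.sqrt m%:R & b' * ln m%:R ^+ p <= Num.sqrt m%:R].
Proof.
move=> a0 b0 b'0.
pose K : R := (b' * (2 * p.+1)%:R ^+ p) ^+ (2 * p.+1).
pose M : R := expR 1 + 128 ^+ 2 + (2 * b) ^+ 2 + (2 / a) ^+ 2 + K.
have K0 : 0 <= K by rewrite exprn_ge0// mulr_ge0 ?exprn_ge0// ltW.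
have e0 : 0 <= expR 1 :> R by exact: expR_ge0.
have h0 : 0 <= 128 ^+ 2 :> R by rewrite exprn_ge0.
have b20 : 0 <= (2 * b) ^+ 2 by exact: sqr_ge0.
have a20 : 0 <= (2 / a) ^+ 2 by exact: sqr_ge0.
have M0 : 0 <= M by rewrite !addr_ge0.
exists (Num.bound M) => m m_gt0 le_m.
have Mm : M <= m%:R.
  by apply: le_trans (ltW (archi_boundP M0)) _; rewrite ler_nat.
have m0' : 0 < m%:R :> R by rewrite ltr0n.
have [Me Mh Mb Ma MK] : [/\ expR 1 <= m%:R :> R, 128 ^+ 2 <= m%:R :> R,
    (2 * b) ^+ 2 <= m%:R, (2 / a) ^+ 2 <= m%:R & K <= m%:R].
  move: Mm; rewrite /M; clear M M0 le_m.
  move: (expR 1) e0 (128 ^+ 2) h0 ((2 * b) ^+ 2) b20 ((2 / a) ^+ 2) a20 K K0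
    m%:R => *.
  by split; lra.
split=> //.
- by rewrite -ler_expR lnK ?posrE.
- exact: sqr_le_sqrt.
- by apply: sqr_le_sqrt; rewrite // mulr_ge0// ltW.
- rewrite mulrC -ler_pdivrMr//; apply: sqr_le_sqrt => //.
  by rewrite divr_ge0// ltW.
- by apply: ln_exp_le_sqrt => //; exact: ltW.
Qed.

Lemma le_subsample_prob (R : realType) (X : pmetricType R)
    (D : probability (labeled X) R) m l
    (E F : m.-tuple (labeled X) -> l.-tuple (labeled X) -> Prop) :
  (forall S S', E S S' -> F S S') -> subsample_prob D E <= subsample_prob D F.
Proof.
move=> EF; rewrite ler_wpM2r ?invr_ge0//; apply: ler_sum => f _.
by apply: le_inner_prob => S; exact: EF.
Qed.

(** * Choice of the parameters and final estimates *)

Theorem theorem5 (R : realType) (delta a b a' b' : R) (p : nat) :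
  0 < delta < 1 -> 0 < a -> 0 < b -> 0 < a' -> 0 < b' ->
  exists (c1 C1 c2 c3 C3 c : R) (q m0 : nat),
    [/\ 0 < c1, 0 < C1, 0 < c2, 0 < c3 & 0 < C3] /\ 0 < c /\
  forall (m : nat), (0 < m)%N -> (m0 <= m)%N ->
  forall (X : pmetricType R) (tbar : R) (T : {fset X}),
    0 < tbar ->
    is_net tbar [set x | x \in T] [set: X] ->
    a * Num.sqrt m%:R <= #|` T|%:R <= b * Num.sqrt m%:R ->
  forall Net : multiset X -> R -> {fset X}, is_net_procedure Net ->
  let conclusion (l : nat) (D : probability (labeled X) R) (A : learner X) :=
    (c1 / Num.sqrt m%:R <= bayes_error D <= C1 / Num.sqrt m%:R) /\
    c <= subsample_prob D (fun (S_in : m.-tuple (labeled X))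
                               (S_l : l.-tuple (labeled X)) =>
      c2 * m%:R `^ (- 4^-1) / ln m%:R ^+ q <= err (A S_l) D /\
      c3 / Num.sqrt m%:R / ln m%:R ^+ q
        <= Gmin Net delta S_in
        <= C3 / Num.sqrt m%:R * ln m%:R ^+ q) in
  let admissible (l : nat) :=
    a' * Num.sqrt m%:R / ln m%:R ^+ p <= l%:R
      <= b' * Num.sqrt m%:R * ln m%:R ^+ p in
  (forall (A : learner X) (l : nat), admissible l ->
     exists D : probability (labeled X) R, conclusion l D A) /\
  (forall (A : probability (borel X) R -> learner X) (l : nat), admissible l ->
     exists D : probability (labeled X) R, conclusion l D (A (marginal D))).
Proof.
move=> d01 a_gt0 b_gt0 _ b'_gt0.
have [m0 large] := eventually_large p a_gt0 b_gt0 b'_gt0.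
have dln0 : 0 <= ln (delta^-1) := ln_inv_ge0 d01.
have bb_gt0 : 0 < b + b' by rewrite addr_gt0.
(* The third constant is [q * (a * s / 2) / 8] without its logarithms, for the mass [q] set below.
   In the fifth, [b + 1 + ln (delta^-1)] covers the complexity term of [GB] and 3/2 the noise,
   rounded up. *)
exists 1, 1, (a / (64 * (b + b'))), (1 / 2), (5 * (b + 3 + ln (delta^-1))).
(* The exponent [p.+1] dominates both [p], from the light mass, and 1, from [GB]. *)
exists (1 / 16), p.+1, m0.
split; first by split => //; rewrite ?divr_gt0 ?mulr_gt0//; lra.
split=> // m m_gt0 le_m X tbar T t_gt0 [_ Tsep _] /andP[aT Tb] Net NetP.
move=> conclusion admissible.
(* A learner without the marginal is one that ignores it. *)
suff second (A : probability (borel X) R -> learner X) l : admissible l ->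
    exists D : probability (labeled X) R, conclusion l D (A (marginal D)).
  by split=> // A l al; exact: (second (fun=> A)).
case/andP=> _ le_l; rewrite {admissible}.
have {large}[ln1 s128 sb as2 lns] := large m m_gt0 le_m.
set s := Num.sqrt m%:R in aT Tb le_l s128 sb as2 lns *.
set lam := ln m%:R in le_l ln1 lns *.
have mE : m%:R = s ^+ 2 by rewrite sqr_sqrtr.
have s_gt0 : 0 < s by apply: lt_le_trans s128.
have L1 : 1 <= lam ^+ p by rewrite exprn_ege1.
have L_gt0 : 0 < lam ^+ p by apply: lt_le_trans L1.
have T2 : (2 <= #|` T|)%N by rewrite -(ler_nat R) (le_trans as2).
have [x0 x0T] : exists x0, x0 \in T by apply/fset0Pn; rewrite -cardfs_gt0 ltnW.
pose J : finType := (T `\ x0)%fset.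
pose pt (j : J) : X := val j.
have pt_inj : injective pt by exact: val_inj.
have ptP j : pt j != x0 /\ pt j \in T by apply/fsetD1P; exact: valP.
have cardJ : #|J|.+1 = #|` T| by rewrite -cardfE (cardfsD1 x0 T) x0T.
(* As [#|J| <= b * s] and [l <= b' * s * lam ^+ p], this mass gives [#|J| * q <= 1 / 4], which
   leaves [x0] heavy enough, and [l * q <= 1 / 2]. *)
pose q := (4 * (b + b') * s * lam ^+ p)^-1.
have den_gt0 : 0 < 4 * (b + b') * s * lam ^+ p by rewrite !mulr_gt0.
have q_gt0 : 0 < q by rewrite invr_gt0.
have eta_gt0 : 0 < s^-1 by rewrite invr_gt0.
have cardJR : #|J|%:R + 1 = #|` T|%:R :> R by rewrite natr1 cardJ.
have b'P : 0 <= b' * s * lam ^+ p by rewrite !mulr_ge0// ltW.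
have bP : b * s <= b * s * lam ^+ p by rewrite ler_peMr// mulr_ge0// ltW.
have Jq : #|J|%:R * q <= 1 / 4 by rewrite ler_pdivrMr//; lra.
have eta_le : s^-1 <= 1 - s^-1 - #|J|%:R * q.
  have : s^-1 <= 1 / 128 by rewrite -div1r ler_pdivrMr//; lra.
  by lra.
have J_gt0 : (0 < #|J|)%N by rewrite -ltnS cardJ.
have J_small : (2 * #|J|.+1 <= m)%N.
  rewrite -(ler_nat R) natrM cardJ mE expr2.
  by apply: (@le_trans _ _ (2 * b * s)); [lra|rewrite ler_pM2r].
have lm : (l <= m)%N.
  rewrite -(ler_nat R) mE expr2; apply: le_trans le_l _.
  by rewrite mulrAC ler_pM2r.
have lq : l%:R * q <= 1 / 2.
  have : 0 <= b * s * lam ^+ p by rewrite !mulr_ge0// ltW.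
  by rewrite ler_pdivrMr//; lra.
have m_eta : 128 <= m%:R * s^-1.
  by rewrite mE expr2 mulfK// gt_eqF.
have place_sep i i' : place x0 pt i != place x0 pt i' ->
    tbar <= mdist (place x0 pt i) (place x0 pt i').
  have placeT k : place x0 pt k \in T by case: k => [j|?] //=; case: (ptP j).
  by apply: Tsep; exact: placeT.
have pt_neq j : pt j != x0 by case: (ptP j).
pose D := hard x0 pt (ltW q_gt0) eta_gt0 eta_le.
(* The learner must be fixed before [sg] is chosen: it is fed the marginal of a constant labelling,
   which all labellings share. *)
have [sg Psg] := hard_labelling pt_inj pt_neq (ltW q_gt0) eta_gt0 eta_le
  NetP t_gt0 place_sep d01 (A (marginal (D [ffun=> true])))
  J_gt0 J_small lm lq m_eta.
exists (D sg); split.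
  by rewrite bayes_error_hard// !div1r lexx.
rewrite (_ : marginal (D sg) = marginal (D [ffun=> true])); last first.
  exact: marginal_hard.
apply: le_trans Psg _; apply: le_subsample_prob => S S' [err_ge Gmin_in].
have lam_gt0 : 0 < lam by apply: lt_le_trans ln1.
have lamS : lam ^+ p <= lam ^+ p.+1 by rewrite ler_weXn2l.
have lamS1 : lam <= lam ^+ p.+1 by rewrite exprS ler_peMr// ltW.
have lamS_gt0 : 0 < lam ^+ p.+1 by rewrite exprn_gt0.
split.
  apply: le_trans err_ge.
  (* The power of [m] is bounded by 1: the error is at least of order [1 / lam ^+ p]. *)
  apply: (@le_trans _ _ (a / (64 * (b + b')) / lam ^+ p)).
    apply: ler_pM.
    - by rewrite mulr_ge0 ?powR_ge0// divr_ge0// ltW// mulr_gt0.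
    - by rewrite invr_ge0 ltW.
    - rewrite ler_piMr ?divr_ge0 ?(ltW a_gt0) ?mulr_ge0 ?(ltW bb_gt0)//.
      rewrite -[leRHS](powRr0 m%:R); apply: ler_powR; first by rewrite ler1n.
      by rewrite oppr_le0.
    - by rewrite lef_pV2 ?posrE.
  have -> : a / (64 * (b + b')) / lam ^+ p = q * (a * s / 2 / 8).
    by rewrite /q; field; rewrite !gt_eqF.
  by rewrite ler_pM2l//; lra.
case/andP: Gmin_in => G_ge G_le; apply/andP; split.
  apply: le_trans G_ge; rewrite ler_pdivrMr//.
  have : s^-1 * 1 <= s^-1 * lam ^+ p.+1.
    by rewrite ler_pM2l//; apply: le_trans lamS1.
  by lra.
apply: le_trans G_le _; rewrite -/lam -!mulrA ler_pM2l//.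
(* Every term is compared with [s^-1 * lam], where [m = s ^+ 2]; [s^-1 <= 1] and [1 <= lam] absorb
   the lower-order ones. *)
apply: (@le_trans _ _ ((b + 3 + ln delta^-1) * (s^-1 * lam))); last first.
  by rewrite ler_pM2l ?ler_pM2l//; lra.
have u1 : s^-1 <= 1 by rewrite invf_le1//; lra.
have Jlam : #|J|.+2%:R * lam <= (b * s + 1) * lam.
  by rewrite ler_pM2r// -(natr1 #|J|.+1) -(natr1 #|J|); lra.
have ulam : s^-1 <= s^-1 * lam by rewrite ler_peMr// ltW.
have uulam : s^-1 * s^-1 * lam <= s^-1 * lam.
  by rewrite ler_pM2r// ler_piMr// ltW.
have uuD : s^-1 * s^-1 * ln delta^-1 <= s^-1 * lam * ln delta^-1.
  by rewrite ler_wpM2r//; apply: le_trans ulam; rewrite ler_piMr// ltW.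
have -> : m%:R = s * s by rewrite mE expr2.
rewrite invfM.
have : (#|J|.+2%:R * lam + ln delta^-1) * (s^-1 * s^-1) <=
    ((b * s + 1) * lam + ln delta^-1) * (s^-1 * s^-1).
  by rewrite ler_wpM2r ?lerD2r// mulr_ge0// ltW.
have -> : ((b * s + 1) * lam + ln delta^-1) * (s^-1 * s^-1) =
  b * (s^-1 * lam) + s^-1 * s^-1 * lam + s^-1 * s^-1 * ln delta^-1.
  by field; rewrite gt_eqF.
by lra.
Qed.
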